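(* Let $S$ be an inverse semigroup without zero with $|S/\sigma| \ge 2$. Then: (i) $\mathrm{gr}(\Gamma(S^0)) = \infty$ if and only if $|S/\sigma| = 2$ and at least one of the $\sigma$-classes contains only one element of $S$; (ii) $\mathrm{gr}(\Gamma(S^0)) = 4$ if and only if $|S/\sigma| = 2$ and every $\sigma$-class contains at least two elements of $S$; (iii) $\mathrm{gr}(\Gamma(S^0)) = 3$ if and only if $|S/\sigma| \ge 3$.
   Context: For an inverse semigroup $T$ with set of idempotents $E(T)$, the natural partial order is: $a \le b$ iff $a = eb$ for some $e \in E(T)$. A semigroup ''with zero'' is one with at least two elements containing an element $0$ such that $0x = x0 = 0$ for all $x$; thus a one-element semigroup counts as being without zero. If $S$ has no zero, $S^0 = S \cup \{0\}$ denotes $S$ with an external zero adjoined. For an inverse semigroup $T$ with zero and $a, b \in T$, $\omega(a,b) = \{c \in T : c \le a \text{ and } c \le b\}$. The zero-divisor graph $\Gamma(T)$ is the simple undirected graph with vertex set $Z(T)^\times = \{a \in T\setminus\{0\} : \exists\, b \in T \setminus\{0\},\ \omega(a,b) = \{0\}\}$, in which two distinct vertices $a, b$ are adjacent iff $\omega(a,b) = \{0\}$. The least group congruence $\sigma$ on $S$ is given by: $a\,\sigma\,b$ iff $ea = fb$ for some $e, f \in E(S)$. The girth $\mathrm{gr}$ of a graph is the length of a shortest cycle, or $\infty$ if there are no cycles. *)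

(* Defs.v *)
From HB Require Import structures.
From mathcomp Require Import all_boot.
From mathcomp Require Import boolp classical_sets functions cardinality.
From mathcomp Require Import constructive_ereal.

Set Implicit Arguments.
Unset Strict Implicit.
Unset Printing Implicit Defensive.

Local Open Scope classical_set_scope.
Local Open Scope card_scope.
Local Open Scope group_scope.

Section InverseSemigroups.
Variable T : semigroupType.
Implicit Types a b c e f z : T.

Definition inverse_semigroup : Prop :=
  forall a, exists! b, a * b * a = a /\ b * a * b = b.

Definition idempotents : set T := [set e | e * e = e].

Definition natural_le a b : Prop := exists2 e, idempotents e & a = e * b.

Definition absorbing z : Prop := forall x, z * x = z /\ x * z = z.

(* By convention a one-element semigroup is without zero. *)
Definition with_zero : Prop :=
  (exists x y : T, x <> y) /\ (exists z, absorbing z).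

Definition sigma a b : Prop :=
  exists e f, [/\ idempotents e, idempotents f & e * a = f * b].

Definition sigma_class a : set T := [set b | sigma a b].

Definition sigma_quotient : set (set T) := range sigma_class.

Definition omega a b : set T := [set c | natural_le c a /\ natural_le c b].

(* In the next two definitions, z is the zero of T. *)
Definition zero_divisors z : set T :=
  [set a | a <> z /\ exists2 b, b <> z & omega a b = [set z]].

(* The vertex type is the subtype of zero divisors of T. *)
Definition zero_divisor_graph z : rel (zero_divisors z) :=
  [rel a b | (a != b) && `[< omega (val a) (val b) = [set z] >]].

End InverseSemigroups.

Arguments inverse_semigroup : clear implicits.
Arguments idempotents : clear implicits.
Arguments with_zero : clear implicits.
Arguments sigma_quotient : clear implicits.
Arguments zero_divisor_graph {T} z.

Section AdjoinZero.
Variable S : semigroupType.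

(* S^0, with None as the adjoined zero. *)
Definition adjoin_zero : Type := option S.

HB.instance Definition _ := Choice.on adjoin_zero.

Definition adjoined_zero : adjoin_zero := None.

Definition adjoin_zero_mul (x y : adjoin_zero) : adjoin_zero :=
  if x is Some a then if y is Some b then Some (a * b) else None else None.

Lemma adjoin_zero_mulA : associative adjoin_zero_mul.
Proof. by case=> [a|] [b|] [c|] //=; rewrite mulgA. Qed.

HB.instance Definition _ := isSemigroup.Build adjoin_zero adjoin_zero_mulA.

Lemma absorbing_adjoined_zero : absorbing adjoined_zero.
Proof. by case. Qed.

Lemma inverse_semigroup_adjoin_zero :
  inverse_semigroup S -> inverse_semigroup adjoin_zero.
Proof.
move=> invS [a|]; last by exists None; split=> // -[b|] [].
have [b [[aba bab] b_uniq]] := invS a; exists (Some b); split.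
  by split; congr Some.
by case=> [c|] [] // [aca] [cac]; congr Some; apply: b_uniq.
Qed.

End AdjoinZero.

Section Girth.
Variables (V : choiceType) (e : rel V).

Definition has_cycle_of_length (n : nat) : Prop :=
  exists c : seq V, [/\ size c = n, (2 < n)%N & ucycle e c].

Definition girth : \bar nat :=
  if pselect (exists n, `[< has_cycle_of_length n >]) is left ex_cycle
  then (ex_minn ex_cycle)%:E else +oo%E.

End Girth.

(* Main.v *)
(** The natural partial order of S restricts that of S^0, so omega(a, b) = {0}
    for a, b in S exactly when a and b are not sigma-related.  As there are at
    least two sigma-classes, every element of S is a vertex, and the graph is
    complete multipartite with the sigma-classes as parts.  Such a graph has a
    triangle iff it has three parts; with only two parts, any cycle of length
    at least four starts x, y, z, w with x, z in one part and y, w in the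
    other, so that x, y, z, w is already a 4-cycle. *)
Require Import Defs.
From mathcomp Require Import all_boot.
From mathcomp Require Import boolp functions.
From mathcomp Require Import classical_sets cardinality constructive_ereal.

Local Open Scope classical_set_scope.
Local Open Scope card_scope.

(** * Small cardinalities expressed by explicit witnesses *)

Section Cardinality.

(** An injection of [I_n] into [A] lists [n] distinct elements, and conversely [nth] is injective on
    the indices of a duplicate-free sequence. Cycles are sequences too, so this lets cardinal bounds
    meet the graph side. *)
Lemma card_ge_II_seqP (T : eqType) (n : nat) (A : set T) :
  `I_n #<= A <-> exists s : seq T, [/\ uniq s, size s = n & {in s, forall x, A x}].
Proof.
split=> [/card_leP[f]|[[|x0 s] [Us szs sA]]]; last 2 first.
- by rewrite -szs II0.
(* The head serves as the default of [nth]; the empty sequence, which offers none, is already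
   settled. *)
- have inj : {in `I_n &, injective (nth x0 (x0 :: s))}.
    move=> i j; rewrite !inE /= => ltin ltjn /eqP.
    by rewrite nth_uniq ?szs // => /eqP.
  rewrite -(card_le_eql (inj_card_eq inj)); apply: subset_card_le.
  by move=> _ [i /= ltin <-]; apply/sA/mem_nth; rewrite szs.
pose g (i : 'I_n) : T := val (f (SigSub (mem_set (ltn_ord i : `I_n i)))).
exists [seq g i | i : 'I_n]; split.
- rewrite map_inj_uniq ?enum_uniq // => i j /val_inj.
  by move/('inj_f (mem_setT _) (mem_setT _)) => [] /val_inj.
- by rewrite size_image card_ord.
- by move=> _ /mapP[i _ ->]; apply: set_valP.
Qed.

Lemma card_ge_II2P (T : eqType) (A : set T) :
  `I_2 #<= A <-> exists x y, [/\ A x, A y & x != y].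
Proof.
split=> [/card_ge_II_seqP[[|x [|y [|? ?]]] [] // /andP[+ _] _ sA]|[x [y [Ax Ay xy]]]].
  by rewrite inE => xy; exists x, y; split=> //; apply: sA; rewrite !inE eqxx ?orbT.
apply/card_ge_II_seqP; exists [:: x; y]; split=> //=; first by rewrite inE xy.
by move=> z; rewrite !inE => /orP[] /eqP->.
Qed.

Lemma card_ge_II3P (T : eqType) (A : set T) :
  `I_3 #<= A <->
  exists x y z, [/\ A x, A y & A z] /\ [/\ x != y, y != z & z != x].
Proof.
split=> [/card_ge_II_seqP[[|x [|y [|z [|? ?]]]] [] // + _ sA]|].
  rewrite /= !inE negb_or andbT => /andP[/andP[xy xz] yz].
  exists x, y, z; rewrite xy yz eq_sym xz.
  by split; split=> //; apply: sA; rewrite !inE eqxx ?orbT.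
move=> [x [y [z [[Ax Ay Az] [xy yz zx]]]]].
apply/card_ge_II_seqP; exists [:: x; y; z]; split=> //=.
  by rewrite !inE negb_or xy yz eq_sym zx.
by move=> t; rewrite !inE => /or3P[] /eqP->.
Qed.

(** An infinite set contains a copy of the naturals, hence of [I_n.+1]; for a finite one this is
    antisymmetry of the order on naturals. *)
Lemma card_eq_II_max (T : Type) (n : nat) (A : set T) :
  `I_n #<= A -> A #= `I_n <-> ~ (`I_n.+1 #<= A).
Proof.
move=> leA; split=> [eqA|nleA].
  by rewrite (card_le_eqr eqA) card_le_II ltnn.
have [[m eqA]|/infiniteP natA] := pselect (finite_set A); last first.
  by case: nleA; apply: card_le_trans natA; apply: subset_card_le.
move: leA nleA; rewrite !(card_le_eqr eqA) !card_le_II => lenm /negP.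
by rewrite -leqNgt (card_eql eqA) card_eq_le !card_le_II lenm => ->.
Qed.

End Cardinality.

(** * Girth in terms of cycle lengths *)

Section Girth.
Variables (V : choiceType) (e : rel V).

Lemma girth_eq_infty :
  girth e = +oo%E <-> forall n, ~ has_cycle_of_length e n.
Proof.
rewrite /girth; case: pselect => [ex_c|no_c]; split=> //.
  by move=> no_c; have [n /asboolP /no_c] := ex_c.
by move=> _ n en; apply: no_c; exists n; apply/asboolP.
Qed.

Lemma girth_eq_fin (n : nat) : girth e = n%:E <->
  has_cycle_of_length e n /\ forall m, has_cycle_of_length e m -> (n <= m)%N.
Proof.
rewrite /girth; case: pselect => [ex_c|no_c]; last first.
  by split=> // -[en _]; case: no_c; exists n; apply/asboolP.
case: ex_minnP => m /asboolP em m_min; split=> [[<-]|[en n_min]].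
  by split=> // k /asboolP /m_min.
by congr EFin; apply/anti_leq; rewrite n_min // m_min //; apply/asboolP.
Qed.

End Girth.

(** * Cycles in complete multipartite graphs, whose parts are the fibres of [part] *)

Section CompleteMultipartite.
Set Implicit Arguments.
Unset Strict Implicit.
Variables (V : choiceType) (K : eqType) (part : V -> K) (e : rel V).
Hypothesis eE : forall x y, e x y = (part x != part y).

Lemma multipartite_has_cycle3 :
  has_cycle_of_length e 3 <-> `I_3 #<= range part.
Proof.
split=> [[[|x [|y [|z [|? ?]]]] [] // _ _ /andP[/=]]|].
  rewrite !eE andbT => /and3P[xy yz zx] _.
  apply/card_ge_II3P; exists (part x), (part y), (part z).
  by split; split.
move=> /card_ge_II3P[_ [_ [_ [[[x _ <-] [y _ <-] [z _ <-]] [xy yz zx]]]]].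
exists [:: x; y; z]; split=> //; rewrite /ucycle /= !eE xy yz zx /=.
have part_neq u v : part u != part v -> u != v.
  by apply: contra_neq => ->.
rewrite !inE negb_or (part_neq _ _ xy) (part_neq _ _ yz) eq_sym.
by rewrite (part_neq _ _ zx).
Qed.

Hypothesis no_cycle3 : ~ has_cycle_of_length e 3.

(** Three distinct parts would give a triangle, so every walk alternates between two parts. *)
Lemma multipartite_part_alternates x y z :
  part x != part y -> part y != part z -> part x = part z.
Proof.
move=> xy yz; apply/eqP; apply: contra_notT no_cycle3 => xz.
apply/multipartite_has_cycle3/card_ge_II3P; exists (part x), (part y), (part z).
by rewrite xy yz eq_sym xz; split; split.
Qed.

(** The first four vertices [x], [y], [z], [w] of a longer cycle close up: [x] lies in the part of
    [z], so [w], adjacent to [z], is adjacent to [x]. *)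
Lemma multipartite_has_cycle4_prefix n :
  has_cycle_of_length e n -> has_cycle_of_length e 4.
Proof.
move=> [c [szc n_gt2 /andP[cyc_c Uc]]].
case: c => [|x [|y [|z [|w c]]]] in szc cyc_c Uc *; subst n => //.
  by case: no_cycle3; exists [:: x; y; z]; split=> //; apply/andP.
move: cyc_c Uc; rewrite /= !eE => /and4P[xy yz zw _].
rewrite !inE !negb_or.
move=> /and4P[/and4P[xNy xNz xNw _] /and3P[yNz yNw _] /andP[zNw _] _].
exists [:: x; y; z; w]; split=> //; rewrite /ucycle /= !eE !inE !negb_or.
rewrite xy yz zw xNy xNz xNw yNz yNw zNw (multipartite_part_alternates xy yz).
by rewrite eq_sym zw.
Qed.

Lemma multipartite_has_cycle4 : `I_2 #<= range part ->
  has_cycle_of_length e 4 <->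
  forall k, range part k -> `I_2 #<= part @^-1` [set k].
Proof.
move=> /card_ge_II2P[_ [_ [[x _ <-] [y _ <-] xy]]]; split; last first.
  move=> fib2.
  (* Two vertices from each of the two parts, taken alternately, form the cycle. *)
  have /card_ge_II2P[x1 [x2 [/= x1x x2x x12]]] := fib2 _ (imageT part x).
  have /card_ge_II2P[y1 [y2 [/= y1y y2y y12]]] := fib2 _ (imageT part y).
  have part_neq u v : part u = part x -> part v = part y -> (u == v) = false.
    by move=> ux vy; apply/negbTE/(contra_neq _ xy) => uv; rewrite -ux -vy uv.
  exists [:: x1; y1; x2; y2]; split=> //; rewrite /ucycle /= !eE !inE !negb_or.
  rewrite x1x x2x y1y y2y xy (eq_sym (part y)) xy x12 y12 (eq_sym y1).
  by rewrite !part_neq.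
move=> [[|a [|b [|c [|d [|? ?]]]]] [] // _ _ /andP[/=]].
rewrite !eE !inE !negb_or andbT => /and4P[ab bc cd da].
move=> /and4P[/and3P[_ ac _] /andP[_ bd] _ _] _ [u _ <-].
have pac := multipartite_part_alternates ab bc.
have pbd := multipartite_part_alternates bc cd.
(* Opposite vertices of the cycle share a part. A vertex [u] outside the part of [a] lies in that of
   [b], by alternation along [u], [a], [b]. *)
apply/card_ge_II2P; have [au|au] := eqVneq (part a) (part u).
  by exists a, c; split=> //=; rewrite -pac.
rewrite eq_sym in au; have ub := multipartite_part_alternates au ab.
by exists b, d; split=> //=; rewrite -pbd.
Qed.

End CompleteMultipartite.

(** * Commuting idempotents, and [sigma] as an equivalence relation *)

Section InverseSemigroup.
Set Implicit Arguments.
Unset Strict Implicit.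
Variable S : semigroupType.
Hypothesis invS : inverse_semigroup S.
Local Open Scope group_scope.
Implicit Types a b c e f g h x : S.

Lemma inverse_unique a b c : a * b * a = a -> b * a * b = b ->
  a * c * a = a -> c * a * c = c -> b = c.
Proof.
move=> aba bab aca cac; have [d [_ d_uniq]] := invS a.
by rewrite -(d_uniq b) // -(d_uniq c).
Qed.

(* The inverse x of ef equals fxe, hence is idempotent, hence is its own
   inverse, so that x = ef. *)
Lemma idempotentsM e f :
  idempotents S e -> idempotents S f -> idempotents S (e * f).
Proof.
rewrite /idempotents /= => ee ff; have [x [[efx xef] _]] := invS (e * f).
have fxeE : x = f * x * e.
  apply: (inverse_unique (a := e * f)) => //.
    by rewrite -[RHS]efx !mulgA -(mulgA _ f f) ff -(mulgA _ e e) ee.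
  have -> : f * x * e * (e * f) * (f * x * e) = f * (x * (e * f) * x) * e.
    by rewrite !mulgA -(mulgA _ e e) ee -(mulgA _ f f) ff.
  by rewrite xef.
have xx : x * x = x.
  rewrite {1 2}fxeE.
  have -> : f * x * e * (f * x * e) = f * (x * (e * f) * x) * e by rewrite !mulgA.
  by rewrite xef -fxeE.
suff -> : e * f = x by [].
by apply: (inverse_unique (a := x)) => //; rewrite !xx.
Qed.

(** Both [e * f] and [f * e] are inverses of [e * f]. *)
Lemma idempotentsC e f :
  idempotents S e -> idempotents S f -> e * f = f * e.
Proof.
move=> ie jf; have := idempotentsM jf ie; have := idempotentsM ie jf.
move: ie jf; rewrite /idempotents /= => ee ff efef fefe.
have absorb (g h : S) : g * g = g -> h * h = h -> g * h * (g * h) = g * h ->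
    g * h * (h * g) * (g * h) = g * h.
  move=> gg hh ghgh.
  by rewrite !mulgA -(mulgA _ h h) hh -(mulgA _ g g) gg -mulgA.
by apply: (inverse_unique (a := e * f)); rewrite ?efef ?absorb.
Qed.

Lemma sigma_refl a : sigma a a.
Proof.
(* [S] need not have an identity; the idempotent [a * b], with [b] the inverse of [a], replaces
   it. *)
have [b [[aba _] _]] := invS a.
have ab_idem : idempotents S (a * b) by rewrite /idempotents /= mulgA aba.
by exists (a * b), (a * b).
Qed.

Lemma sigma_sym a b : sigma a b -> sigma b a.
Proof. by move=> [e [f [ie jf eafb]]]; exists f, e. Qed.

(** From [e * a = f * b] and [g * b = h * c], commuting [g] with [f] gives [g * e * a = g * f * b =
    f * g * b = f * h * c]. *)
Lemma sigma_trans a b c : sigma a b -> sigma b c -> sigma a c.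
Proof.
move=> [e [f [ie jf eafb]]] [g [h [ig ih gbhc]]].
exists (g * e), (f * h); split; [exact: idempotentsM..|].
by rewrite -!mulgA eafb -gbhc !mulgA (idempotentsC ig jf).
Qed.

Lemma sigma_class_eq a b : sigma_class a = sigma_class b <-> sigma a b.
Proof.
split=> [eq_ab|ab].
  by have : sigma_class b b := sigma_refl b; rewrite -eq_ab.
apply/seteqP; split=> c; apply: sigma_trans => //; exact: sigma_sym.
Qed.

End InverseSemigroup.

(** * The zero-divisor graph of [S] with a zero adjoined *)

Section AdjoinZeroGraph.
Set Implicit Arguments.
Unset Strict Implicit.
Variable S : semigroupType.
Hypothesis invS : inverse_semigroup S.
Hypothesis ge2_classes : `I_2 #<= sigma_quotient S.
Implicit Types a b c : S.

Local Notation S0 := (adjoin_zero S).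
Local Notation zero := (adjoined_zero S).

Lemma natural_le_Some a b :
  natural_le (Some a : S0) (Some b) <-> natural_le a b.
Proof.
split=> [[[e|] // [ee] [aeb]]|[e ee aeb]]; first by exists e.
by exists (Some e); [congr Some|congr Some].
Qed.

Lemma natural_le_zero (x : S0) : natural_le zero x.
Proof. by exists zero. Qed.

Lemma omega_Some_eq0 a b :
  omega (Some a : S0) (Some b) = [set zero] <-> ~ sigma a b.
Proof.
split=> [ab0 [e [f [ie jf eafb]]]|nab].
  (* The common value [e * a = f * b] is a nonzero common lower bound. *)
  suff : omega (Some a : S0) (Some b) (Some (e * a)%g) by rewrite ab0.
  by split; apply/natural_le_Some; [exists e|exists f].
apply/seteqP; split=> [[c|] //= []|_ ->]; last by split; exact: natural_le_zero.
move=> /natural_le_Some[e ie cea] /natural_le_Some[f jf cfb].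
by case: nab; exists e, f; rewrite -cea.
Qed.

Lemma zero_divisors_Some a : zero_divisors zero (Some a : S0).
Proof.
split=> //; suff [b nab] : exists b, ~ sigma a b.
  by exists (Some b) => //; apply/omega_Some_eq0.
(* Of two representatives of distinct classes, at least one is not related to [a]. *)
have [_ [_ [[x _ <-] [y _ <-]]]] := (card_ge_II2P _ _).1 ge2_classes.
have [ax|nax] := pselect (sigma a x); last by exists x.
have [ay|nay] := pselect (sigma a y); last by exists y.
case/eqP; apply/sigma_class_eq => //.
by apply: sigma_trans ay => //; exact: sigma_sym.
Qed.

Definition vertex a : zero_divisors zero :=
  SigSub (mem_set (zero_divisors_Some a)).

(* The default value set0 is never taken: zero is not a vertex. *)
Definition vertex_class (x : zero_divisors zero) : set S :=
  oapp (@sigma_class S) set0 (val x).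

Lemma vertex_inj : injective vertex.
Proof. by move=> a b /(congr1 val) []. Qed.

Lemma vertex_surj (x : zero_divisors zero) : exists a, x = vertex a.
Proof.
case: x => -[a|] xZ; last by have [] := set_mem xZ.
by exists a; apply: val_inj.
Qed.

Lemma zero_divisor_graphE x y :
  zero_divisor_graph zero x y = (vertex_class x != vertex_class y).
Proof.
have [[a ->] [b ->]] := (vertex_surj x, vertex_surj y).
rewrite /zero_divisor_graph /vertex_class /=; apply/andP/idP => [[_ /asboolP]|].
  by move=> /omega_Some_eq0; apply: contra_notN => /eqP/sigma_class_eq; apply.
(* Distinctness of the vertices, demanded by adjacency, follows from that of their classes. *)
move=> ab; split; first by apply: contra_neq ab => /vertex_inj->.
by apply/asboolP/omega_Some_eq0 => /(sigma_class_eq invS)/eqP; apply/negP.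
Qed.

Lemma range_vertex_class : range vertex_class = sigma_quotient S.
Proof.
apply/seteqP; split=> [_ [x _ <-]|_ [a _ <-]]; last by exists (vertex a).
by have [a ->] := vertex_surj x; exists a.
Qed.

(** The injection [vertex] maps the class onto the corresponding part of the graph, so class sizes
    can be read off the parts. *)
Lemma card_vertex_class_fiber C : sigma_quotient S C ->
  vertex_class @^-1` [set C] #= C.
Proof.
move=> [a _ <-].
have <- : vertex @` sigma_class a = vertex_class @^-1` [set sigma_class a].
  apply/seteqP; split=> [_ [b ab <-]|x /=].
    by apply/sigma_class_eq => //; apply: sigma_sym.
  have [b ->] := vertex_surj x; move=> /sigma_class_eq ba.
  by exists b => //; apply: sigma_sym; apply: ba.
by apply: inj_card_eq => b c _ _; exact: vertex_inj.
Qed.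

Lemma card_sigma_class_gt0 C : sigma_quotient S C -> `I_1 #<= C.
Proof.
move=> [a _ <-]; apply/card_ge_II_seqP; exists [:: a]; split=> // b.
by rewrite inE => /eqP->; exact: sigma_refl.
Qed.

End AdjoinZeroGraph.

(** * The three values of the girth *)

Theorem theorem4p7 (S : semigroupType) (invS : inverse_semigroup S)
    (S_no_zero : ~ with_zero S) (ge2_classes : `I_2 #<= sigma_quotient S) :
  [/\ girth (zero_divisor_graph (adjoined_zero S)) = +oo%E <->
        sigma_quotient S #= `I_2 /\
        exists2 C, sigma_quotient S C & C #= `I_1,
      girth (zero_divisor_graph (adjoined_zero S)) = 4%N%:E <->
        sigma_quotient S #= `I_2 /\
        forall C, sigma_quotient S C -> `I_2 #<= C
    & girth (zero_divisor_graph (adjoined_zero S)) = 3%N%:E <->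
        `I_3 #<= sigma_quotient S].
Proof.
set e := zero_divisor_graph _; pose part := @vertex_class S.
have eE : forall x y, e x y = (part x != part y).
  exact: zero_divisor_graphE.
have rangeE : range part = sigma_quotient S.
  exact: range_vertex_class.
have cycle3 : has_cycle_of_length e 3 <-> `I_3 #<= sigma_quotient S.
  by rewrite -rangeE; exact: multipartite_has_cycle3.
have card2 : sigma_quotient S #= `I_2 <-> ~ has_cycle_of_length e 3.
  by rewrite cycle3; exact: card_eq_II_max.
have cycle4 : ~ has_cycle_of_length e 3 -> has_cycle_of_length e 4 <->
    forall C, sigma_quotient S C -> `I_2 #<= C.
  move=> no3; rewrite (multipartite_has_cycle4 eE no3) rangeE //.
  have fibE C : sigma_quotient S C -> part @^-1` [set C] #= C.
    exact: card_vertex_class_fiber.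
  by split=> fib2 C SC; have := fib2 C SC; rewrite (card_le_eqr (fibE C SC)).
(* Classes are nonempty, so one with fewer than two elements is a singleton. *)
have small_class : (exists2 C, sigma_quotient S C & C #= `I_1) <->
    ~ forall C, sigma_quotient S C -> `I_2 #<= C.
  split=> [[C SC C1] /(_ C SC)|].
    by apply/card_eq_II_max => //; exact: card_sigma_class_gt0.
  move=> /existsNP[C /not_implyP[SC nC]]; exists C => //.
  by apply/card_eq_II_max => //; exact: card_sigma_class_gt0.
split.
(* Excluding lengths 3 and 4 suffices, since without triangles any cycle yields one of length 4. *)
- rewrite girth_eq_infty card2 small_class; split=> [no_c|[no3 no4] n].
    by split=> [|/cycle4]; [exact: no_c|move=> /(_ (no_c 3)); exact: no_c].
  by move=> /(multipartite_has_cycle4_prefix eE no3)/(cycle4 no3).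
- rewrite girth_eq_fin card2; split=> [[c4 min4]|[no3 /(cycle4 no3) c4]].
    have no3 : ~ has_cycle_of_length e 3 by move=> /min4.
    by split=> //; apply/cycle4.
  (* Cycles have length above 2 by definition, so only length 3 must be excluded for 4 to be
     minimal. *)
  split=> // n c_n; have [c [_ n_gt2 _]] := c_n.
  by rewrite ltn_neqAle n_gt2 andbT; apply: contra_notN no3 => /eqP->.
- rewrite girth_eq_fin -cycle3; split=> [[]//|c3]; split=> //.
  by move=> n [c []].
Qed.
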